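(* Let $\pi\in IP(n,k)$ and $\iota\in I(n,k)$ have common $A=\{a_1,\ldots,a_k\}$ and $C=\{1,c_2,\ldots,c_k,n+1\}$. If the equivalence index classes are equal, $[a_i]_\pi=[a_i]_\iota$ for $i=1,\ldots,k$, then each $\pi(i)$ is the rank of $\iota(i)$, describing where to move it when rearranging the elements of $\iota$ in order; in other words, the inverse permutation $\pi^-$ is a permutation of indices such that $$\iota(\pi^-(1))\le\iota(\pi^-(2))\le\cdots\le\iota(\pi^-(n)).$$
   Context: $[n]=\{1,\ldots,n\}$. $I(n,k)$ is the set of idempotent maps $\iota:[n]\to[n]$ ($\iota(\iota(x))=\iota(x)$ for all $x$) with image of cardinality $k$. For $\iota\in I(n,k)$, $A=\{a_1<\cdots<a_k\}$ is its set of fixed points, $[a_i]_\iota=\{x\in[n]:\iota(x)=a_i\}$, and $C=\{c_1,\ldots,c_k,c_{k+1}\}$ is given by $c_1=1$, $c_{i+1}=c_i+|[a_i]_\iota|$ (so $c_{k+1}=n+1$). An idempotent permutation of degree $k$ ($1\le k\le n$) is a permutation $\pi$ of $[n]$ together with a distinguished set of indices $A=\{a_1<\cdots<a_k\}\subseteq[n]$ such that the values $c_i=\pi(a_i)$ satisfy $1=c_1<c_2<\cdots<c_k$; put $c_{k+1}=n+1$, $C=\{c_1,\ldots,c_k,n+1\}$, and $[a_i]_\pi=\{x\in[n]:c_i\le\pi(x)<c_{i+1}\}$. $IP(n,k)$ denotes the set of idempotent permutations of degree $k$. $\pi^-$ is the inverse permutation of $\pi$. *)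

(* Defs.v *)
From mathcomp Require Import all_boot all_fingroup.

Set Implicit Arguments.
Unset Strict Implicit.
Unset Printing Implicit Defensive.

(* [n] = {1, ..., n} is represented by 'I_n, the ordinal x (with nat value in
   0 .. n-1) standing for the number x + 1; [num] recovers that number. *)
Definition num n (x : 'I_n) : nat := x.+1.

Definition idem_maps n k : {set {ffun 'I_n -> 'I_n}} :=
  [set f : {ffun 'I_n -> 'I_n} |
     [forall x, f (f x) == f x] && (#|f @: [set: 'I_n]| == k)].

Definition fixpts n (f : {ffun 'I_n -> 'I_n}) : {set 'I_n} :=
  [set x | f x == x].

Definition idem_class n (f : {ffun 'I_n -> 'I_n}) (a : 'I_n) : {set 'I_n} :=
  [set x | f x == a].

(* [:: c_1; ...; c_(k+1)] with c_1 = 1 and c_(i+1) = c_i + #|[a_i]_f|.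
   Here and below, [enum A] for A : {set 'I_n} is the increasing enumeration
   a_1 < ... < a_k of A. *)
Definition idem_cuts n (f : {ffun 'I_n -> 'I_n}) : seq nat :=
  1 :: scanl (fun c a => c + #|idem_class f a|) 1 (enum (fixpts f)).

Definition perm_marks n (pi : {perm 'I_n}) (A : {set 'I_n}) : seq nat :=
  [seq num (pi a) | a <- enum A].

(* IP(n,k): the distinguished set of indices is part of the data, hence the pair. *)
Definition idem_perms n k : {set {perm 'I_n} * {set 'I_n}} :=
  [set p : {perm 'I_n} * {set 'I_n} |
     [&& 0 < k <= n, #|p.2| == k, head 0 (perm_marks p.1 p.2) == 1
       & sorted ltn (perm_marks p.1 p.2)]].

Definition perm_cuts n (pi : {perm 'I_n}) (A : {set 'I_n}) : seq nat :=
  rcons (perm_marks pi A) n.+1.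

(* [a_i]_pi, where a = a_i in A; the index i is counted from 0. *)
Definition perm_class n (pi : {perm 'I_n}) (A : {set 'I_n}) (a : 'I_n) :
    {set 'I_n} :=
  let i := index a (enum A) in
  [set x | nth 0 (perm_cuts pi A) i <= num (pi x) < nth 0 (perm_cuts pi A) i.+1].

(* Each pi(x) is the rank of f(x): in the nondecreasing rearrangement of
   f(1), ..., f(n), the entry in position pi(x) is f(x).  The positions of nth
   start at 0, so position number num (pi x) is the nth index pi x. *)
Definition gives_ranks n (pi : {perm 'I_n}) (f : {ffun 'I_n -> 'I_n}) : Prop :=
  forall x : 'I_n,
    nth 0 (sort leq [seq num (f y) | y <- enum 'I_n]) (pi x) = num (f x).

(* Main.v *)
(* If iota(y) < iota(x), then the class of iota(y) ends where the class of
   iota(x) begins or earlier; since both maps have the same classes, pi(y) < pi(x).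
   Hence pi(x) <= pi(y) implies iota(x) <= iota(y), so iota o pi^- is
   nondecreasing, and it lists the same values as iota. *)
Require Import Defs.
From mathcomp Require Import all_boot all_fingroup.

Lemma sorted_enum_ord_set n (A : {set 'I_n}) :
  sorted (fun x y : 'I_n => x < y) (enum A).
Proof.
(* [enum A] unfolds to a filter of the enumeration of ['I_n], and filtering keeps the order. *)
rewrite {1}/enum_mem -enumT; apply: sorted_filter => [y x z|]; first exact: ltn_trans.
have : sorted ltn (map (@nat_of_ord n) (enum 'I_n)).
  by rewrite val_enum_ord iota_ltn_sorted.
by rewrite sorted_map.
Qed.

Lemma index_enum_lt n (A : {set 'I_n}) (a b : 'I_n) :
  a \in A -> b \in A -> a < b -> index a (enum A) < index b (enum A).
Proof.
move=> aA bA ab; rewrite ltnNge; apply/negP => le_ba.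
have lt_trans : transitive (fun x y : 'I_n => x < y) by move=> y x z; exact: ltn_trans.
case: (ltngtP (index b (enum A)) (index a (enum A))) le_ba => // [lt_ba|eq_ba] _.
  have := sorted_ltn_index lt_trans (sorted_enum_ord_set n A).
  by move/(_ b a); rewrite !mem_enum => /(_ bA aA lt_ba); rewrite ltnNge ltnW.
have ba : b = a by apply: (index_inj a _ _ eq_ba); rewrite mem_enum.
by rewrite ba ltnn in ab.
Qed.

(** The upper cut of the class of [a] is at most the lower cut of the class of [b], because [a]
    precedes [b] in [enum A] and the marks increase. *)
Lemma perm_class_lt n (pi : {perm 'I_n}) (A : {set 'I_n}) (a b x y : 'I_n) :
  sorted ltn (perm_marks pi A) -> a \in A -> b \in A -> a < b ->
  x \in perm_class pi A a -> y \in perm_class pi A b -> pi x < pi y.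
Proof.
move=> marks_lt aA bA /(index_enum_lt _ _ _ _ aA bA) lt_ab.
rewrite !inE => /andP[_ x_lt] /andP[y_ge _].
suff cut_le : nth 0 (perm_cuts pi A) (index a (enum A)).+1 <=
              nth 0 (perm_cuts pi A) (index b (enum A)).
  by rewrite -ltnS; apply: leq_trans x_lt (leq_trans cut_le y_ge).
have b_lt : index b (enum A) < size (perm_marks pi A).
  by rewrite size_map index_mem mem_enum.
(* Since [(index a (enum A)).+1 <= index b (enum A) < size (perm_marks pi A)], both cuts are marks;
   the appended [n.+1] is not reached. *)
rewrite /perm_cuts !nth_rcons b_lt (leq_ltn_trans lt_ab b_lt).
apply: (sorted_leq_nth leq_trans leqnn) => //; last exact: leq_ltn_trans lt_ab b_lt.
by apply: sub_sorted marks_lt => i j; exact: ltnW.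
Qed.

Theorem theorem3p12 (n k : nat) (pi : {perm 'I_n}) (A : {set 'I_n})
    (f : {ffun 'I_n -> 'I_n}) :
  (pi, A) \in idem_perms n k ->
  f \in idem_maps n k ->
  fixpts f = A ->
  perm_cuts pi A =i idem_cuts f ->
  (forall a : 'I_n, a \in A -> perm_class pi A a = idem_class f a) ->
  gives_ranks pi f /\
  sorted leq [seq num (f (pi^-1%g j)) | j <- enum 'I_n].
Proof.
rewrite !inE /= => /and4P[_ _ _ marks_lt] /andP[/forallP f_idem _] fixA _ classE.
(* By idempotence [f x] is a fixed point, so [classE] applies to the class of [f x], which contains
   [x]. *)
have fA x : f x \in A by rewrite -fixA inE.
have f_class x : x \in perm_class pi A (f x) by rewrite classE // inE.
have f_mono x y : pi x <= pi y -> f x <= f y.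
  apply: contraTT; rewrite -!ltnNge => lt_f.
  exact: perm_class_lt _ _ _ _ _ _ _ marks_lt (fA y) (fA x) lt_f (f_class y) (f_class x).
have f_sorted : sorted leq [seq num (f (pi^-1%g j)) | j <- enum 'I_n].
  rewrite sorted_map.
  have : sorted leq (map (@nat_of_ord n) (enum 'I_n)).
    by rewrite val_enum_ord iota_sorted.
  rewrite sorted_map; apply: sub_sorted => i j /= le_ij.
  by rewrite ltnS f_mono ?permKV.
split=> // x.
(* Two sorted lists with the same multiset of entries are equal; here the bijection [pi^-1] only
   reorders the indices. *)
have -> : sort leq [seq num (f y) | y <- enum 'I_n] =
          [seq num (f (pi^-1%g j)) | j <- enum 'I_n].
  apply: (sorted_eq leq_trans anti_leq) => //; first exact/sort_sorted/leq_total.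
  rewrite perm_sort (map_comp (fun y => num (f y)) (fun j => pi^-1%g j)).
  apply: perm_map; apply: uniq_perm; first exact: enum_uniq.
    by rewrite map_inj_uniq ?enum_uniq //; exact: perm_inj.
  move=> y; rewrite mem_enum; apply/esym/mapP.
  by exists (pi y); rewrite ?mem_enum ?permK.
(* The entry at position [pi x] is the value at [pi^-1 (pi x) = x]; the default [x] is never
   returned, as [pi x < n]. *)
by rewrite (nth_map x) ?size_enum_ord // nth_ord_enum permK.
Qed.
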